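(* Let $h:\mathbf{C}\to\mathbf{C}$ be a topologically mixing homeomorphism of the Cantor space such that for every pair of nonempty open sets $U,V\subseteq\mathbf{C}$ there exist a compact set $K_{U,V}\subseteq\mathbf{C}$ and $m(U,V)\in\mathbb{N}$ with: $K_{U,V}$ is nowhere dense in $\mathbf{C}$ and $h(K_{U,V})=K_{U,V}$; and $h^m(K_{U,V}\cap U)\cap V\ne\emptyset$ for all $m\ge m(U,V)$. Then there exist $\Phi$ such that $\mathbf{F}_\Phi$ is a Lelek fence and a lifting $\hat h$ of $h$ to $\mathbf{F}_\Phi$ which is a topologically mixing homeomorphism.
   Context: For $\Phi=(\varphi^L,\varphi^U)$ with $\varphi^L,\varphi^U:\mathbf{C}\to[0,1]$, $\varphi^L$ lower semicontinuous, $\varphi^U$ upper semicontinuous, $\varphi^L\le\varphi^U$, the fence is $\mathbf{F}_\Phi=\{(x,t)\in\mathbf{C}\times[0,1]:\varphi^L(x)\le t\le\varphi^U(x)\}$ and $\mathbf{F}_\Phi(x)=\{t:(x,t)\in\mathbf{F}_\Phi\}$. $\mathbf{F}_\Phi$ is a Lelek fence if $\varphi^L\equiv0$, $\varphi^U$ is positive on a dense subset of $\mathbf{C}$, and the graph $\{(x,\varphi^U(x)):x\in\mathbf{C}\}$ is dense in $\mathbf{F}_\Phi$. A map $\hat h:\mathbf{F}_\Phi\to\mathbf{F}_\Phi$ is a lifting of $h$ if $\hat h(x,t)=(h(x),s)$ with $s\in\mathbf{F}_\Phi(h(x))$ for all $(x,t)\in\mathbf{F}_\Phi$. *)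

(* Defs.v *)
From HB Require Import structures.
From mathcomp Require Import all_boot all_order all_algebra.
From mathcomp Require Import all_classical all_reals all_analysis.
Set Implicit Arguments. Unset Strict Implicit. Unset Printing Implicit Defensive.
Import Order.TTheory GRing.Theory Num.Theory.
Import numFieldNormedType.Exports.
Local Open Scope classical_set_scope.
Local Open Scope ring_scope.

Notation C := cantor_space.

Section Fences.
Variable R : realType.

Definition lsc (f : C -> R) : Prop :=
  forall x (a : R), a < f x -> \forall y \near x, a < f y.
Definition usc (f : C -> R) : Prop :=
  forall x (a : R), f x < a -> \forall y \near x, f y < a.

Definition admissible (phiL phiU : C -> R) : Prop :=
  [/\ forall x, 0 <= phiL x <= 1, forall x, 0 <= phiU x <= 1,
      lsc phiL, usc phiU & forall x, phiL x <= phiU x].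

Definition fence (phiL phiU : C -> R) : set (C * R) :=
  [set p | 0 <= p.2 <= 1 /\ phiL p.1 <= p.2 <= phiU p.1].

Definition Lelek_fence (phiL phiU : C -> R) : Prop :=
  [/\ forall x, phiL x = 0,
      exists2 D : set C, dense D & forall x, D x -> 0 < phiU x
    & fence phiL phiU `<=` closure ([set (x, phiU x) | x in [set: C]] : set (C * R))].

Definition lifting (phiL phiU : C -> R) (h : C -> C) (hh : C * R -> C * R) :=
  forall p, fence phiL phiU p ->
    (hh p).1 = h p.1 /\ fence phiL phiU (hh p).

End Fences.

Definition homeo_on (T : topologicalType) (A : set T) (f : T -> T) : Prop :=
  [/\ {within A, continuous f}, set_fun A A f, set_inj A f, set_surj A A f &
      exists2 g : T -> T, (forall y, A y -> A (g y) /\ f (g y) = y) &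
                          {within A, continuous g}].

(* f is topologically mixing on A (A invariant, open sets relative to A) *)
Definition mixing_on (T : topologicalType) (A : set T) (f : T -> T) : Prop :=
  forall U V : set T, open U -> open V -> (A `&` U) !=set0 -> (A `&` V) !=set0 ->
    exists N : nat, forall n, (N <= n)%N ->
      (iter n f @` (A `&` U)) `&` (A `&` V) !=set0.

Definition nowhere_dense (T : topologicalType) (K : set T) : Prop :=
  interior (closure K) = set0.

(* Main.v *)
Require Import Defs.
From HB Require Import structures.
From mathcomp Require Import all_boot all_order all_algebra.
From mathcomp Require Import all_classical all_reals all_analysis.
From mathcomp Require Import lra.
Import Order.TTheory GRing.Theory Num.Theory.
Import numFieldNormedType.Exports.
Local Open Scope classical_set_scope.
Local Open Scope ring_scope.

(** The upper function is phi = lim exp (- F_n) for an increasing sequence of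
    continuous F_n >= 0, and the lifting scales each fibre linearly:
    (x, t) |-> (h x, t * exp (- w x)), where w is the uniform limit of
    F_n o h - F_n.  Hence phi (h x) = exp (- w x) * phi x, and the graph of phi
    is invariant.  Mixing and density of the graph both follow if, for all basic
    open U, V and all height windows below the current heights over U and V,
    there are for every large m points x in U with h^m x in V whose heights
    phi x and phi (h^m x) lie in the prescribed windows.

    One such request is met at each stage.  Choose small clopen U' in U and V' in V
    whose orbit segments of length N do not meet, and add to F_n a multiple of a
    tent function equal to 1 on U', decreasing by 1/N with each application of h or
    of its inverse, and similarly for V'.  For N large the cocycle F_n o h - F_n
    changes by at most 2^-n, while the heights over U' and V' become the required
    ones.  The points x are found in the given invariant set K_{U',V'}.  As the
    union of the finitely many sets K used so far is closed, invariant and nowhere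
    dense, U' and V' can be taken disjoint from it, so that later stages do not
    change the heights over these sets. *)

Set Implicit Arguments.
Unset Strict Implicit.
Unset Printing Implicit Defensive.

(** * Tent functions along orbits of a clopen set *)

Section Tent.
Context {R : realType} {T : topologicalType} (h g : T -> T).
Hypotheses (hK : cancel h g) (gK : cancel g h).
Hypotheses (hc : continuous h) (gc : continuous g).

(** The union of the h^i(E) for |i| <= j, where g is the inverse of h. *)
Definition orbit_nbhd (E : set T) (j : nat) : set T :=
  [set x | exists2 i, (i <= j)%N & E (iter i h x) \/ E (iter i g x)].

Lemma orbit_nbhd_fwd E j x : orbit_nbhd E j x -> orbit_nbhd E j.+1 (h x).
Proof.
move=> [[|i] ij [Ex|Ex]]; try (exists 1%N; rewrite ?ltnS//=; right; by rewrite hK).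
- by exists i; [exact: (leq_trans (ltnW ij) (leqnSn j))|left; rewrite -iterSr].
- by exists i.+2 => //; right; rewrite iterSr hK.
Qed.

Lemma orbit_nbhd_bwd E j x : orbit_nbhd E j (h x) -> orbit_nbhd E j.+1 x.
Proof.
move=> [[|i] ij [Ex|Ex]]; try (exists 1%N; rewrite ?ltnS//=; by left).
- by exists i.+2 => //; left; rewrite iterSr.
- exists i; first exact: (leq_trans (ltnW ij) (leqnSn j)).
  by right; move: Ex; rewrite iterSr hK.
Qed.

Lemma continuous_iter (f : T -> T) n : continuous f -> continuous (iter n f).
Proof.
move=> fc; elim: n => [|n IH] x /=; first exact: cvg_id.
by apply: (@continuous_comp _ _ _ (iter n f) f); [exact: IH|exact: fc].
Qed.

Lemma clopen_orbit_nbhd E j : clopen E -> clopen (orbit_nbhd E j).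
Proof.
move=> cE; elim: j => [|j IH].
  suff -> : orbit_nbhd E 0 = E by [].
  apply/seteqP; split=> x; last by move=> Ex; exists 0%N => //; left.
  by case=> -[|//] _ [].
have -> : orbit_nbhd E j.+1 =
    orbit_nbhd E j `|` (iter j.+1 h @^-1` E `|` iter j.+1 g @^-1` E).
  apply/seteqP; split=> x.
    case=> i; rewrite leq_eqVlt => /predU1P[->|ij] Ex; [by right|left].
    by exists i.
  case=> [[i ij Ex]|Ex]; last by exists j.+1.
  by exists i => //; exact: leqW.
by apply: clopenU => //; apply: clopenU;
  apply: preimage_clopen => //; exact: continuous_iter.
Qed.

(** If the least [i] with [E (iter i h x)] or [E (iter i g x)] is below [N], the value is
    [1 - i / N]; otherwise it is 0. *)
Definition tent (N : nat) (E : set T) (x : T) : R :=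
  N%:R^-1 * \sum_(j < N) \1_(orbit_nbhd E j) x.

Lemma continuous_indic_clopen (A : set T) :
  clopen A -> continuous (\1_A : T -> R).
Proof.
move=> [oA cA] x.
have [Ax|Ax] := pselect (A x).
  apply: (@cvg_near_cst T R (\1_A x) (\1_A : T -> R)).
  apply: filterS (open_nbhs_nbhs (conj oA Ax)) => y Ay.
  by rewrite !indicE !mem_set.
apply: (@cvg_near_cst T R (\1_A x) (\1_A : T -> R)).
apply: filterS (open_nbhs_nbhs (conj (closed_openC cA) Ax)) => y Ay.
by rewrite !indicE !memNset.
Qed.

Lemma continuous_tent N E : clopen E -> continuous (tent N E).
Proof.
move=> cE x; apply: cvgMl_tmp.
have cj j : continuous (\1_(orbit_nbhd E j) : T -> R).
  exact/continuous_indic_clopen/clopen_orbit_nbhd.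
elim: N => [|N IH].
  by under eq_fun do rewrite big_ord0; rewrite big_ord0; exact: cvg_cst.
under eq_fun do rewrite big_ord_recr/=.
by rewrite big_ord_recr/=; apply: cvgD => //; exact: cj.
Qed.

Lemma tent_ge0 N E x : 0 <= tent N E x.
Proof. by rewrite mulr_ge0// sumr_ge0. Qed.

Lemma tent_in N E x : (0 < N)%N -> E x -> tent N E x = 1.
Proof.
move=> N0 Ex; rewrite /tent (eq_bigr (fun=> 1)) => [|j _].
  by rewrite sumr_const card_ord mulVf// pnatr_eq0 -lt0n.
by rewrite indicE mem_set//; exists 0%N => //; left.
Qed.

Lemma tent_out N E x :
  (forall i, (i < N)%N -> ~ E (iter i h x) /\ ~ E (iter i g x)) ->
  tent N E x = 0.
Proof.
move=> Ex; rewrite /tent big1 ?mulr0// => j _.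
rewrite indicE memNset// => -[i ij]; have [] := Ex i (leq_ltn_trans ij (ltn_ord j)).
by move=> ? ? [].
Qed.

(** After the shift of index, [b 0 >= 0] drops out of the sum and [b N <= 1] enters it. *)
Lemma sum_shift_le (a b : nat -> R) N : (forall j, a j <= b j.+1) ->
  (forall j, 0 <= b j <= 1) -> \sum_(j < N) a j <= \sum_(j < N) b j + 1.
Proof.
move=> ab b01; apply: (@le_trans _ _ (\sum_(j < N) b j.+1)).
  by apply: ler_sum => j _; exact: ab.
have /andP[b0 _] := b01 0%N; have /andP[_ bN] := b01 N.
apply: (@le_trans _ _ (\sum_(j < N.+1) b j)).
  by rewrite big_ord_recl lerDr.
by rewrite big_ord_recr/= lerD2l.
Qed.

(** One application of [h] shifts membership in the nested sets [orbit_nbhd E j] by at most one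
    index, so the two sums differ by at most 1. *)
Lemma tent_lip N E x : `|tent N E (h x) - tent N E x| <= N%:R^-1.
Proof.
have b01 y j : 0 <= (\1_(orbit_nbhd E j) y : R) <= 1.
  by rewrite indicE ler0n lern1 leq_b1.
have ind A B (y z : T) : (A y -> B z) -> (\1_A y : R) <= \1_B z.
  move=> AB; rewrite !indicE ler_nat.
  case: (pselect (A y)) => [/AB Bz|Ay]; first by rewrite (mem_set Bz) leq_b1.
  by rewrite memNset.
rewrite /tent -mulrBr normrM ger0_norm ?invr_ge0// ler_piMr ?invr_ge0//.
have le1 (y z : T) :
    (forall j, orbit_nbhd E j y -> orbit_nbhd E j.+1 z) ->
    \sum_(j < N) (\1_(orbit_nbhd E j) y : R) <=
    \sum_(j < N) \1_(orbit_nbhd E j) z + 1.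
  move=> yz; apply: (@sum_shift_le (fun j => \1_(orbit_nbhd E j) y)
    (fun j => \1_(orbit_nbhd E j) z)) => // j; exact/ind/yz.
have := le1 _ _ (@orbit_nbhd_fwd E ^~ x); have := le1 _ _ (@orbit_nbhd_bwd E ^~ x).
by rewrite ler_norml; lra.
Qed.

End Tent.

(** * Separating open sets from images of one another *)

Section Separation.
Context {T : topologicalType}.
Hypotheses (hT : hausdorff_space T) (pT : perfect_set [set: T]).

(** Perfectness gives [q] in [V] other than [f p]; disjoint neighbourhoods of [q] and [f p], the
    latter pulled back by [f], cut out the two sets. *)
Lemma separate_image (f : T -> T) (U V : set T) : continuous f ->
  open U -> U !=set0 -> open V -> V !=set0 ->
  exists U' V' : set T, [/\ open U' /\ U' !=set0, open V' /\ V' !=set0,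
    U' `<=` U, V' `<=` V & forall x, U' x -> ~ V' (f x)].
Proof.
move=> fc oU [p Up] oV V0.
have [q Vq qp] : exists2 q, V q & q != f p.
  have [x [y [Vx Vy xy]]] := (iffLR perfectTP_ex) pT V oV V0.
  have [xp|xp] := eqVneq x (f p); last by exists x.
  by exists y => //; rewrite -xp eq_sym.
move: hT; rewrite open_hausdorff => /(_ _ _ qp)[[A B]/= []].
rewrite !inE => Aq Bp [oA oB AB].
exists (U `&` f @^-1` B), (V `&` A); split.
- by split; [apply: openI => //; exact: open_comp (in1W fc) oB|exists p].
- by split; [exact: openI|exists q].
- exact: subIsetl.
- exact: subIsetl.
- move=> x [_ Bx] [_ Ax]; suff : set0 (f x) by [].
  by rewrite -AB.
Qed.

(** Induction on [N]: shrinking both sets for the next map keeps the separations already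
    obtained. *)
Lemma separate_images (f : nat -> T -> T) (U V : set T) (N : nat) :
  (forall i, continuous (f i)) ->
  open U -> U !=set0 -> open V -> V !=set0 ->
  exists U' V' : set T, [/\ open U' /\ U' !=set0, open V' /\ V' !=set0,
    U' `<=` U, V' `<=` V &
    forall i x, (i < N)%N -> U' x -> ~ V' (f i x)].
Proof.
move=> fc oU U0 oV V0; elim: N => [|N [U1 [V1 [[oU1 U10] [oV1 V10] sU sV IH]]]].
  by exists U, V; split => //; apply: subset_refl.
have [U2 [V2 [oU2 oV2 sU2 sV2 H]]] := separate_image (fc N) oU1 U10 oV1 V10.
exists U2, V2; split => //; [exact: subset_trans sU|exact: subset_trans sV|].
move=> i x; rewrite ltnS leq_eqVlt => /predU1P[->|iN] Ux; first exact: H.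
by move=> /sV2; apply: IH => //; exact: sU2.
Qed.

End Separation.

(** * Cylinders, a countable clopen basis of the Cantor space *)

Definition cylinder (s : seq bool) : set C :=
  [set y | forall i, (i < size s)%N -> y i = nth false s i].

Lemma cylinder_nonempty s : cylinder s !=set0.
Proof. by exists (nth false s). Qed.

Lemma clopen_cylinder s : clopen (cylinder s).
Proof.
elim/last_ind: s => [|s b IH].
  suff -> : cylinder [::] = setT by exact: clopenT.
  by apply/seteqP; split.
have -> : cylinder (rcons s b) =
    cylinder s `&` (fun y : C => y (size s)) @^-1` [set b].
  apply/seteqP; split=> y.
    move=> yb; split=> [i si|] /=; last first.
      by rewrite yb ?size_rcons// nth_rcons ltnn eqxx.
    by rewrite yb ?size_rcons ?ltnS 1?ltnW// nth_rcons si.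
  move=> [ys yb] i; rewrite size_rcons ltnS leq_eqVlt nth_rcons.
  by case: ltngtP => //= [si _|-> _]; [exact: ys|exact: yb].
apply: clopenI => //; apply: preimage_clopen; last exact: proj_continuous.
by split; [exact: discrete_open|rewrite -openC; exact: discrete_open].
Qed.

Lemma cylinder_mkseq (x : C) n y :
  cylinder (mkseq x n) y <-> forall i, (i < n)%N -> y i = x i.
Proof.
by split=> yx i; have := yx i; rewrite ?size_mkseq => yxi iN;
  have := yxi iN; rewrite nth_mkseq.
Qed.

Lemma cylinder_basis (O : set C) (x : C) : open O -> O x ->
  exists2 s, cylinder s x & cylinder s `<=` O.
Proof.
move=> oO Ox.
pose F := filter_from [set: nat] (fun n => cylinder (mkseq x n)).
have FF : Filter F.
  apply: filter_from_filter; first by exists 0%N.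
  move=> i j _ _; exists (maxn i j) => // y /cylinder_mkseq yx.
  by split; apply/cylinder_mkseq => k ki; rewrite yx// leq_max ki ?orbT.
have Fx : F --> x.
  (* In the product topology coordinates are controlled one at a time; a prefix of length [i.+1]
     fixes coordinate [i]. *)
  apply/cvg_sup => i A [B [[D oD <-] /= Dx BA]].
  exists i.+1 => // y /cylinder_mkseq /(_ i (ltnSn i)) yi.
  by apply: BA; rewrite /= /proj yi.
have [n _ nO] := Fx O (open_nbhs_nbhs (conj oO Ox)).
by exists (mkseq x n) => //; exact/cylinder_mkseq.
Qed.

(** * One stage of the construction *)

Section Stages.
Context {R : realType} (h g : C -> C).
Hypotheses (hK : cancel h g) (gK : cancel g h).
Hypotheses (hc : continuous h) (gc : continuous g).
Hypothesis recurrent_sets : forall U V : set C,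
  open U -> open V -> U !=set0 -> V !=set0 ->
  exists K : set C, exists m0 : nat,
    [/\ compact K, nowhere_dense K, h @` K = K &
        forall m, (m0 <= m)%N -> (iter m h @` (K `&` U)) `&` V !=set0].

Definition thin_invariant (K : set C) :=
  [/\ closed K, dense (~` K) & forall x, K (h x) <-> K x].

Lemma thin_invariantU K L :
  thin_invariant K -> thin_invariant L -> thin_invariant (K `|` L).
Proof.
move=> [cK dK iK] [cL dL iL]; split; first exact: closedU.
  move=> O O0 oO; have OK := dK O O0 oO.
  have [x [[Ox Kx] Lx]] := dL _ OK (openI oO (closed_openC cK)).
  by exists x; split=> // -[].
by move=> x; split=> -[/iK|/iL]; by [left|right].
Qed.

Lemma thin_invariant_iter K x i : thin_invariant K ->
  (K (iter i h x) <-> K x) /\ (K (iter i g x) <-> K x).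
Proof.
move=> [_ _ iK]; elim: i => [//|i [IHh IHg]] /=; split.
  by rewrite -IHh.
by rewrite -IHg -(iK (g _)) gK.
Qed.

Lemma thin_recurrent_sets (U V : set C) :
  open U -> open V -> U !=set0 -> V !=set0 ->
  exists K : set C, exists m0 : nat, thin_invariant K /\
    forall m, (m0 <= m)%N -> exists x, [/\ K x, U x & V (iter m h x)].
Proof.
move=> oU oV U0 V0; have [K [m0 [cK nK hKK Km]]] := recurrent_sets oU oV U0 V0.
exists K, m0; split; last first.
  by move=> m /Km[_ [[x [Kx Ux] <-] Vx]]; exists x.
split; first exact: compact_closed cantor_space_hausdorff cK.
  move=> O [x Ox] oO; apply: contrapT => OK.
  suff : interior (closure K) x by rewrite nK.
  exists O; split=> // y Oy; apply: subset_closure.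
  by apply: contrapT => Ky; apply: OK; exists y.
move=> x; split=> Kx; last by rewrite -hKK; exists x.
by move: Kx; rewrite -{1}hKK => -[y Ky /(can_inj hK) <-].
Qed.

Definition stage (F : C -> R) (K : set C) :=
  [/\ continuous F, forall x, 0 <= F x & thin_invariant K].

(** The second and last clauses freeze the values on [K] at all later stages; when the bounds [e]
    are summable, the third makes the cocycles converge uniformly. *)
Definition refines (e : R) (F F' : C -> R) (K K' : set C) :=
  [/\ forall x, F x <= F' x, forall x, K x -> F' x = F x,
      forall x, `|(F' (h x) - F' x) - (F (h x) - F x)| <= e &
      K `<=` K'].

Definition meets_targets (U V : set C) (a b c d : R) (F : C -> R) (K : set C) :=
  exists m0, forall m, (m0 <= m)%N -> exists x,
    [/\ K x, U x, V (iter m h x), a < F x < b & c < F (iter m h x) < d].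

(** [F] may only be raised, hence the premise that it is below [b] somewhere in [U]. The constant
    [A] lifts the value at a point off [K] into the window, and continuity extends this to a
    neighbourhood. *)
Lemma stage_setup (F : C -> R) K (U : set C) (a b : R) :
  stage F K -> open U -> a < b -> (exists2 x, U x & F x < b) ->
  exists (A : R) (U' : set C), [/\ 0 <= A, open U' /\ U' !=set0, U' `<=` U,
    forall x, U' x -> ~ K x & forall x, U' x -> a < F x + A < b].
Proof.
move=> [Fc F0 [cK dK _]] oU ab [x0 Ux0 Fx0].
have oF t : open [set x | F x < t].
  by apply: (@open_comp _ _ F [set y | y < t]); [exact: in1W|exact: open_lt].
have oF' t : open [set x | t < F x].
  by apply: (@open_comp _ _ F [set y | t < y]); [exact: in1W|exact: open_gt].
(* A level inside the window and strictly above [F x0]: the open set where [F < t] then meets [U],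
   hence also the complement of [K]. *)
pose t := (Num.max a (F x0) + b) / 2.
have [at_ Ft tb] : [/\ a < t, F x0 < t & t < b].
  by rewrite /t; case: (leP a (F x0)) => *; split; lra.
have [p [[Up /= pt] Kp]] : ((U `&` [set x | F x < t]) `&` ~` K) !=set0.
  by apply: dK; [exists x0|exact: openI].
exists (t - F p), (((U `&` ~` K) `&` [set x | a - (t - F p) < F x])
   `&` [set x | F x < b - (t - F p)]); split.
- by rewrite subr_ge0 ltW.
- split; first by do ![apply: openI => //]; exact: closed_openC.
  by exists p; split; [split=> //=; lra|rewrite /=; lra].
- by move=> x [[[]]].
- by move=> x [[[]]].
- by move=> x [[_ /= ?] ?]; apply/andP; split; lra.
Qed.

Lemma stage_step (F : C -> R) K (U V : set C) (a b c d e : R) :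
  stage F K -> open U -> open V -> U !=set0 -> a < b -> c < d -> 0 < e ->
  exists F' K', [/\ stage F' K', refines e F F' K K', (K' `&` U) !=set0 &
    (exists2 x, U x & F x < b) -> (exists2 x, V x & F x < d) ->
    meets_targets U V a b c d F' K'].
Proof.
move=> sFK oU oV U0 ab cd e0; have [Fc F0 tK] := sFK.
have [[FU FV]|nF] :=
  pselect ((exists2 x, U x & F x < b) /\ (exists2 x, V x & F x < d)); last first.
  (* Enlarging K even here makes phi positive on a dense set. *)
  have [L [m0 [tL Lm]]] := thin_recurrent_sets oU oU U0 U0.
  have [x [Lx Ux _]] := Lm _ (leqnn m0).
  exists F, (K `|` L); split.
  - by split=> //; exact: thin_invariantU.
  - split=> [y|y|y|y Ky]; [by []|by []|by rewrite subrr normr0 ltW|by left].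
  - by exists x; split=> //; right.
  - by move=> FU FV; case: nF.
have [A [U1 [A0 [oU1 U10] U1U U1K U1F]]] := stage_setup sFK oU ab FU.
have [B [V1 [B0 [oV1 V10] V1V V1K V1F]]] := stage_setup sFK oV cd FV.
(* The tents get heights [A] and [B], so the cocycle changes by at most [(A + B) / N]. *)
pose N := (Num.truncn ((A + B) / e)).+1.
have ABe : (A + B) * N%:R^-1 <= e.
  rewrite ler_pdivrMr ?ltr0n// mulrC -ler_pdivrMr// ltW//.
  by rewrite truncnS_gt.
have [U2 [V2 [[oU2 U20] [oV2 V20] sU2 sV2 hUV]]] :=
  separate_images cantor_space_hausdorff cantor_perfect N
    (fun i => @continuous_iter _ h i hc) oU1 U10 oV1 V10.
(* The tents spread along both [h] and [g], so the separation is repeated for backward iterates. *)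
have [U3 [V3 [[oU3 [p Up]] [oV3 [q Vq]] sU3 sV3 gUV]]] :=
  separate_images cantor_space_hausdorff cantor_perfect N
    (fun i => @continuous_iter _ g i gc) oU2 U20 oV2 V20.
have [s sp sU] := cylinder_basis oU3 Up.
have [s' sq sV] := cylinder_basis oV3 Vq.
set U4 := cylinder s in sU sp; set V4 := cylinder s' in sV sq.
have cU4 : clopen U4 := clopen_cylinder s.
have cV4 : clopen V4 := clopen_cylinder s'.
have [L [m0 [tL Lm]]] :=
  thin_recurrent_sets (proj1 cU4) (proj1 cV4) (ex_intro _ p sp) (ex_intro _ q sq).
pose T1 : C -> R := tent h g N U4; pose T2 : C -> R := tent h g N V4.
have iterhK i : cancel (iter i h) (iter i g).
  by elim: i => // i IH x; rewrite iterSr /= hK IH.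
have itergK i : cancel (iter i g) (iter i h).
  by elim: i => // i IH x; rewrite iterSr /= gK IH.
have U4_1 x : U4 x -> U1 x by move=> /sU/sU3/sU2.
have V4_1 x : V4 x -> V1 x by move=> /sV/sV3/sV2.
(* Iterates of a point of the invariant set [K] stay in [K], which misses [U1]. *)
have T1K x : K x -> T1 x = 0.
  move=> Kx; apply: tent_out => i _.
  by have [Kh Kg] := thin_invariant_iter x i tK;
    split=> /U4_1/U1K; rewrite ?Kh ?Kg.
have T2K x : K x -> T2 x = 0.
  move=> Kx; apply: tent_out => i _.
  by have [Kh Kg] := thin_invariant_iter x i tK;
    split=> /V4_1/V1K; rewrite ?Kh ?Kg.
have T2U x : U4 x -> T2 x = 0.
  move=> Ux; apply: tent_out => i iN; split=> /sV Vx.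
    by apply: (hUV i x iN); [exact/sU3/sU|exact/sV3].
  by apply: (gUV i x iN) Vx; exact: sU.
(* The separations concern iterates of points of [U4]; starting from [V4] they are read through the
   inverse iterate, which exchanges [hUV] and [gUV]. *)
have T1V x : V4 x -> T1 x = 0.
  move=> Vx; apply: tent_out => i iN; split=> /sU Ux.
    by apply: (gUV i _ iN Ux); rewrite iterhK; exact: sV.
  by apply: (hUV i _ iN (sU3 _ Ux)); rewrite itergK; exact/sV3/sV.
have T1U x : U4 x -> T1 x = 1 by exact: tent_in.
have T2V x : V4 x -> T2 x = 1 by exact: tent_in.
have T1_0 x : 0 <= T1 x by exact: tent_ge0.
have T2_0 x : 0 <= T2 x by exact: tent_ge0.
exists (fun x => F x + (A * T1 x + B * T2 x)), (K `|` L); split.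
- split; [|by move=> x; rewrite !addr_ge0// mulr_ge0|exact: thin_invariantU].
  move=> x; apply: cvgD; first exact: Fc.
  by apply: cvgD; apply: cvgMl_tmp; exact: continuous_tent.
- split=> [x|x Kx|x|]; last by left.
  + by rewrite lerDl addr_ge0// mulr_ge0.
  + by rewrite T1K// T2K// !mulr0 !addr0.
  + have -> : F (h x) + (A * T1 (h x) + B * T2 (h x)) -
        (F x + (A * T1 x + B * T2 x)) - (F (h x) - F x) =
      A * (T1 (h x) - T1 x) + B * (T2 (h x) - T2 x) by lra.
    apply: le_trans ABe; rewrite mulrDl (le_trans (ler_normD _ _))//.
    by rewrite !normrM !(ger0_norm A0) !(ger0_norm B0) lerD// ler_wpM2l//;
      exact: tent_lip.
- have [x [Lx Ux _]] := Lm _ (leqnn m0).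
  by exists x; split; [right|exact/U1U/U4_1].
- move=> _ _; exists m0 => m /Lm[x [Lx Ux Vx]]; exists x; split.
  + by right.
  + exact/U1U/U4_1.
  + exact/V1V/V4_1.
  + by rewrite T1U// T2U// mulr0 mulr1 addr0; exact/U1F/U4_1.
  + by rewrite T1V// T2V// mulr0 mulr1 add0r; exact/V1F/V4_1.
Qed.

End Stages.

(** * Enumerating all requests *)

Section StageSequence.
Context {R : realType} (h g : C -> C).
Hypotheses (hK : cancel h g) (gK : cancel g h).
Hypotheses (hc : continuous h) (gc : continuous g).
Hypothesis recurrent_sets : forall U V : set C,
  open U -> open V -> U !=set0 -> V !=set0 ->
  exists K : set C, exists m0 : nat,
    [/\ compact K, nowhere_dense K, h @` K = K &
        forall m, (m0 <= m)%N -> (iter m h @` (K `&` U)) `&` V !=set0].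

(** Requests form a countable type, and the passage from stage [n] to [n.+1] treats the one with
    code [n]. Treating each once suffices: as [F] increases, a bound from above on a later value or
    on the limit holds at stage [n] too. *)
Lemma stage_sequence : exists (F : nat -> C -> R) (K : nat -> set C),
  [/\ forall n, stage h (F n) (K n),
      forall n, refines h (2^-1 ^+ n) (F n) (F n.+1) (K n) (K n.+1),
      forall s, exists n, (K n `&` cylinder s) !=set0 &
      forall (s s' : seq bool) (a b c d : rat), a < b -> c < d -> exists n,
        (exists2 x, cylinder s x & F n x < ratr b) ->
        (exists2 x, cylinder s' x & F n x < ratr d) ->
        meets_targets h (cylinder s) (cylinder s')
          (ratr a) (ratr b) (ratr c) (ratr d) (F n.+1) (K n.+1)].
Proof.
pose goal := (seq bool * seq bool * (rat * rat) * (rat * rat))%type.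
(* Stands in for numbers that encode no request. *)
pose dflt : goal := ([::], [::], (0, 1), (0, 1)).
pose st := {p : (C -> R) * set C | stage h p.1 p.2}.
pose step (ns : nat * st) (t : st) :=
  let: (s, s', (a, b), (c, d)) := odflt dflt (unpickle ns.1) in
  let F := (sval ns.2).1 in let F' := (sval t).1 in
  let K := (sval ns.2).2 in let K' := (sval t).2 in
  refines h (2^-1 ^+ ns.1) F F' K K' /\ (a < b -> c < d ->
    (K' `&` cylinder s) !=set0 /\
    ((exists2 x, cylinder s x & F x < ratr b) ->
     (exists2 x, cylinder s' x & F x < ratr d) ->
     meets_targets h (cylinder s) (cylinder s')
       (ratr a) (ratr b) (ratr c) (ratr d) F' K')).
have [next nextP] : {f : nat * st -> st & forall ns, step ns (f ns)}.
  apply: choice => -[n [[F K] sFK]]; rewrite /step /=.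
  case: (odflt dflt _) => [[[s s'] [a b]] [c d]].
  have e0 : 0 < 2^-1 ^+ n :> R by rewrite exprn_gt0// invr_gt0.
  (* A request with an empty window leaves the stage unchanged. *)
  have [/andP[ab cd]|nabcd] := boolP ((a < b) && (c < d)); last first.
    exists (exist _ (F, K) sFK); split; last by move=> ab cd; rewrite ab cd in nabcd.
    by split=> //= x; rewrite subrr normr0 ltW.
  move: (ab) (cd); rewrite -(ltr_rat R) -(ltr_rat R c) => abR cdR.
  have [F' [K' [sFK' r m1 m2]]] := stage_step hK gK hc gc recurrent_sets sFK
    (proj1 (clopen_cylinder s)) (proj1 (clopen_cylinder s')) (cylinder_nonempty s)
    abR cdR e0.
  by exists (exist _ (F', K') sFK').
have st0 : stage h (fun=> 0 : R) set0.
  split=> //; first by move=> x; exact: cvg_cst.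
  split=> //; first exact: closed0.
  by rewrite setC0 => O [x Ox] _; exists x.
pose S := fix S n :=
  if n is m.+1 then next (m, S m) else exist _ (fun=> 0, set0) st0.
exists (fun n => (sval (S n)).1), (fun n => (sval (S n)).2).
have SP n := nextP (n, S n).
split.
- by move=> n; exact: (svalP (S n)).
- move=> n; have := SP n; rewrite /step.
  by case: (odflt dflt _) => [[[s s'] [a b]] [c d]] [].
- move=> s; have := SP (pickle ((s, s, (0, 1), (0, 1)) : goal)).
  rewrite /step pickleK /= => -[_ /(_ ltr01 ltr01)[m _]].
  by exists (pickle ((s, s, (0, 1), (0, 1)) : goal)).+1.
- move=> s s' a b c d ab cd; exists (pickle ((s, s', (a, b), (c, d)) : goal)).
  have := SP (pickle ((s, s', (a, b), (c, d)) : goal)).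
  by rewrite /step pickleK /= => -[_ /(_ ab cd)[_]].
Qed.

End StageSequence.

(** * The limit height and its cocycle *)

Section Limit.
Context {R : realType} (h : C -> C) (F : nat -> C -> R) (K : nat -> set C).
Hypothesis FK : forall n, stage h (F n) (K n).
Hypothesis FS :
  forall n, refines h (2^-1 ^+ n) (F n) (F n.+1) (K n) (K n.+1).

(** Exponentiating before the limit lets [F n x] diverge, with height 0 there; an infimum of
    continuous functions is upper semicontinuous. *)
Definition height (x : C) : R := inf (range (fun n => expR (- F n x))).

(** Since F_n o h - F_n changes by at most 2^-n, adding or subtracting 2 * 2^-n
    makes it monotone in n, so its limit is an infimum. *)
Definition drift (x : C) : R :=
  inf (range (fun n => F n (h x) - F n x + 2 * 2^-1 ^+ n)).

Lemma stage_fun_homo x : {homo F ^~ x : m n / (m <= n)%N >-> m <= n}.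
Proof. by apply/nondecreasing_seqP => n; have [] := FS n. Qed.

Lemma expR_stage_homo x :
  {homo (fun n => expR (- F n x)) : m n / (m <= n)%N >-> n <= m}.
Proof. by move=> m n mn; rewrite ler_expR lerN2; exact: stage_fun_homo. Qed.

Lemma expR_stage_lb x : lbound (range (fun n => expR (- F n x))) 0.
Proof. by move=> _ [n _ <-]; exact: expR_ge0. Qed.

Lemma height_le n x : height x <= expR (- F n x).
Proof.
by apply: ge_inf; [exists 0; exact: expR_stage_lb|exists n].
Qed.

Lemma height_ge0 x : 0 <= height x.
Proof.
by apply: lb_le_inf; [exists (expR (- F 0 x)), 0%N|exact: expR_stage_lb].
Qed.

Lemma height_le1 x : height x <= 1.
Proof.
apply: le_trans (height_le 0 x) _; rewrite -expR0 ler_expR oppr_le0.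
by have [_ F0 _] := FK 0; exact: F0.
Qed.

Lemma cvg_height x : expR (- F n x) @[n --> \oo] --> height x.
Proof.
apply: nonincreasing_cvgn; first exact: expR_stage_homo.
by exists 0; exact: expR_stage_lb.
Qed.

(** At such [x] the sequence is constant from stage [n] on. *)
Lemma height_stage n x : K n x -> height x = expR (- F n x).
Proof.
move=> Kx; have Km k : K (k + n)%N x /\ F (k + n)%N x = F n x.
  elim: k => // k [Kk Fk]; have [_ FE _ KS] := FS (k + n)%N.
  by split; [exact: KS|rewrite FE].
apply: (@cvg_unique _ _ (expR (- F m x) @[m --> \oo])) => //.
  exact: cvg_height.
suff : expR (- F (m + n)%N x) @[m --> \oo] --> expR (- F n x).
  by rewrite (cvg_shiftn n (fun m => expR (- F m x))).
by under eq_fun do rewrite (Km _).2; exact: cvg_cst.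
Qed.

Lemma usc_height : usc height.
Proof.
move=> x a; rewrite /height => /inf_lt[|_ [n _ <-] Fa].
  by exists (expR (- F 0 x)), 0%N.
have cF : {for x, continuous (fun y => expR (- F n y))}.
  apply: (@continuous_comp _ _ _ (fun y => - F n y) expR);
    last exact: continuous_expR.
  by have [Fc _ _] := FK n; exact: (continuousN (Fc x)).
have oa : open [set r : R | r < a] by exact: open_lt.
apply: (@filterS _ (nbhs x) (nbhs_filter x) _ _ _
  (cF _ (open_nbhs_nbhs (conj oa Fa)))).
move=> y /=.
exact: le_lt_trans (height_le n y).
Qed.

Let delta n x := F n (h x) - F n x.

Let upper n x := delta n x + 2 * 2^-1 ^+ n.
Let lower n x := delta n x - 2 * 2^-1 ^+ n.

Let halfS n : 2 * 2^-1 ^+ n.+1 = 2^-1 ^+ n :> R.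
Proof. by rewrite exprS mulrA divff// mul1r. Qed.

Let deltaS n x : `|delta n.+1 x - delta n x| <= 2^-1 ^+ n.
Proof. by have [_ _ H _] := FS n; exact: H. Qed.

Let upper_homo x : {homo upper ^~ x : m n / (m <= n)%N >-> n <= m}.
Proof.
apply/nonincreasing_seqP => n; have := deltaS n x.
by rewrite /upper halfS ler_norml => /andP[] *; lra.
Qed.

Let lower_homo x : {homo lower ^~ x : m n / (m <= n)%N >-> m <= n}.
Proof.
apply/nondecreasing_seqP => n; have := deltaS n x.
by rewrite /lower halfS ler_norml => /andP[] *; lra.
Qed.

Let half_gt0 n : 0 < 2^-1 ^+ n :> R.
Proof. by rewrite exprn_gt0// invr_gt0. Qed.

Let lower_le_upper m n x : lower m x <= upper n x.
Proof.
apply: (le_trans (lower_homo x (leq_maxl m n))).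
apply: le_trans (upper_homo x (leq_maxr m n)).
by rewrite /lower /upper; have := half_gt0 (maxn m n); lra.
Qed.

Lemma drift_approx n x :
  `|drift x - (F n (h x) - F n x)| <= 2 * 2^-1 ^+ n.
Proof.
have lb m : lbound (range (upper ^~ x)) (lower m x).
  by move=> _ [k _ <-]; exact: lower_le_upper.
have : drift x <= upper n x by apply: ge_inf; [exists (lower 0 x)|exists n].
have : lower n x <= drift x by apply: lb_le_inf; [exists (upper 0 x), 0%N|].
by rewrite /lower /upper /delta ler_norml => *; apply/andP; split; lra.
Qed.

Lemma cvg_half : 2 * 2^-1 ^+ n @[n --> \oo] --> (0 : R).
Proof.
rewrite -[X in _ --> X](mulr0 2); apply: cvgMl_tmp; apply: cvg_expr.
by rewrite ger0_norm ?invr_ge0// invf_lt1// ltr1n.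
Qed.

Lemma cvg_drift x : F n (h x) - F n x @[n --> \oo] --> drift x.
Proof.
apply/cvgrPdist_le => e e0; near=> n.
apply: le_trans (drift_approx n x) _.
near: n; have /cvgrPdist_le/(_ e e0) := cvg_half.
apply: filterS => n; rewrite sub0r normrN; apply: le_trans; exact: ler_norm.
Unshelve. all: end_near. Qed.

Lemma continuous_drift : continuous h -> continuous drift.
Proof.
move=> hc x; apply/cvgrPdist_le => e e0.
(* Two thirds pay for replacing [drift] by stage [n] at [x] and at [y], one for the continuity of
   that stage. *)
have e3 : 0 < e / 3 by rewrite divr_gt0.
have /cvgrPdist_le/(_ _ e3)[n _ /(_ n (leqnn n))] := cvg_half.
rewrite /= sub0r normrN ger0_norm => [ne|]; last by rewrite mulr_ge0 ?ltW.
have [Fc _ _] := FK n.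
have dc : {for x, continuous (delta n)}.
  apply: cvgB; last exact: Fc.
  by apply: (@continuous_comp _ _ _ h); [exact: hc|exact: Fc].
move/cvgrPdist_le : dc => /(_ _ e3); apply: filterS => y.
have := drift_approx n x; have := drift_approx n y.
rewrite -/(delta _ _) -/(delta _ _).
by rewrite !ler_norml => /andP[? ?] /andP[? ?] /andP[? ?]; apply/andP; split; lra.
Qed.

(** The identity holds at every stage; its multiplicative form passes to the limit even where the
    height is 0. *)
Lemma height_drift x : height (h x) = height x * expR (- drift x).
Proof.
apply: (@cvg_unique _ _ (expR (- F n (h x)) @[n --> \oo])) => //.
  exact: cvg_height.
have -> : (fun n => expR (- F n (h x))) =
    (fun n => expR (- F n x) * expR (- (F n (h x) - F n x))).
  by apply/funext => n; rewrite -expRD; congr expR; lra.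
apply: cvgM; first exact: cvg_height.
apply: continuous_cvg; first exact: continuous_expR.
by apply: cvgN; exact: cvg_drift.
Qed.

End Limit.

(** * Linear scaling of the fibres *)

Section SkewProduct.
Context {R : realType} (h g : C -> C) (phi w : C -> R).
Hypotheses (hK : cancel h g) (gK : cancel g h).
Hypotheses (hc : continuous h) (gc : continuous g) (wc : continuous w).
Hypothesis phi01 : forall x, 0 <= phi x <= 1.
Hypothesis phiM : forall x, phi (h x) = phi x * expR (- w x).

(** By [phiM] the fibre [[0, phi x]] is stretched exactly onto [[0, phi (h x)]]. *)
Definition scale_fibers (p : C * R) : C * R := (h p.1, p.2 * expR (- w p.1)).

Definition unscale_fibers (p : C * R) : C * R := (g p.1, p.2 * expR (w (g p.1))).

Lemma scale_fibersK : cancel scale_fibers unscale_fibers.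
Proof.
move=> [x t]; rewrite /scale_fibers /unscale_fibers /=.
by rewrite hK -mulrA -expRD addNr expR0 mulr1.
Qed.

Lemma unscale_fibersK : cancel unscale_fibers scale_fibers.
Proof.
move=> [x t]; rewrite /scale_fibers /unscale_fibers /=.
by rewrite gK -mulrA -expRD addrN expR0 mulr1.
Qed.

Lemma continuous_fiber_scaling (k : C -> C) (v : C -> R) : continuous k ->
  continuous v -> continuous (fun p : C * R => (k p.1, p.2 * expR (v p.1))).
Proof.
move=> kc vc p.
have c1 : (fun q : C * R => q.1) @ p --> p.1.
  exact: (@cvg_fst C R (nbhs p.1) (nbhs p.2) (nbhs_filter p.2)).
have c2 : (fun q : C * R => q.2) @ p --> p.2.
  exact: (@cvg_snd C R (nbhs p.1) (nbhs p.2) (nbhs_filter p.1)).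
have fc : {for p, continuous (fun q : C * R => k q.1)}.
  exact: (cvg_comp _ _ c1 (kc p.1)).
have ec : {for p, continuous (fun q : C * R => expR (v q.1))}.
  exact: (cvg_comp _ _ (cvg_comp _ _ c1 (vc p.1)) (@continuous_expR R _)).
have sc : {for p, continuous (fun q : C * R => q.2 * expR (v q.1))}.
  exact: cvgM c2 ec.
exact: (cvg_pair fc sc).
Qed.

Lemma continuous_scale_fibers : continuous scale_fibers.
Proof.
by apply: (@continuous_fiber_scaling h (fun x => - w x)) => // x; exact/continuousN/wc.
Qed.

Lemma continuous_unscale_fibers : continuous unscale_fibers.
Proof.
apply: (@continuous_fiber_scaling g (w \o g)) => // x.
by apply: (@continuous_comp _ _ _ g w); [exact: gc|exact: wc].
Qed.

Local Notation fen := (fence (fun=> 0) phi).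

Lemma fenceP x t : fen (x, t) <-> 0 <= t <= phi x.
Proof.
split=> [[]//|tx]; split=> //=; have /andP[_ p1] := phi01 x.
by move/andP: tx => [-> /= tx]; exact: le_trans tx p1.
Qed.

Lemma scale_fibers_fence p : fen p -> fen (scale_fibers p).
Proof.
case: p => x t /fenceP /andP[t0 tx]; apply/fenceP.
by rewrite phiM mulr_ge0 ?expR_ge0// ler_wpM2r ?expR_ge0.
Qed.

Lemma unscale_fibers_fence p : fen p -> fen (unscale_fibers p).
Proof.
case: p => x t /fenceP /andP[t0 tx]; apply/fenceP.
rewrite mulr_ge0 ?expR_ge0//=; have := phiM (g x); rewrite gK => phix.
have -> : phi (g x) = phi x * expR (w (g x)).
  by rewrite phix -mulrA -expRD addNr expR0 mulr1.
by rewrite ler_wpM2r ?expR_ge0.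
Qed.

Lemma lifting_scale_fibers : lifting (fun=> 0) phi h scale_fibers.
Proof. by move=> p /scale_fibers_fence. Qed.

Lemma homeo_on_scale_fibers : homeo_on fen scale_fibers.
Proof.
split.
- exact/continuous_subspaceT/continuous_scale_fibers.
- exact: scale_fibers_fence.
- by move=> p q _ _; exact: (can_inj scale_fibersK).
- move=> p fp; exists (unscale_fibers p); first exact: unscale_fibers_fence.
  exact: unscale_fibersK.
- exists unscale_fibers; last exact/continuous_subspaceT/continuous_unscale_fibers.
  by move=> p fp; split; [exact: unscale_fibers_fence|exact: unscale_fibersK].
Qed.

(** The graph of [phi] is invariant, so mixing can be tested on orbits of top endpoints. *)
Lemma iter_scale_fibers_graph n x :
  iter n scale_fibers (x, phi x) = (iter n h x, phi (iter n h x)).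
Proof. by elim: n => //= n ->; rewrite /scale_fibers /= phiM. Qed.

End SkewProduct.

(** * From height windows to density of the graph and mixing *)

Section LelekFence.
Context {R : realType} (h : C -> C) (phi : C -> R).
Hypothesis phi01 : forall x, 0 <= phi x <= 1.
Hypothesis phi_dense : forall s, exists2 x, cylinder s x & 0 < phi x.

Local Notation fen := (fence (fun=> 0) phi).

(** The window []a, b[] for [F] seen through [expR (- F)], which reverses its ends; rational ends
    keep the requests countable. *)
Definition band (b a : rat) : set R :=
  [set t | expR (- ratr b) < t < expR (- ratr a)].

(** The band surrounds a positive height [t'] in the fibre of some [y]. Its lower end is thus below
    [phi y], as [hits_bands] demands, while [phi y] may lie above the band. *)
Lemma fence_localize (O : set (C * R)) : open O -> (fen `&` O) !=set0 ->
  exists s a b, [/\ a < b, exists2 x, cylinder s x & expR (- ratr b) < phi x &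
    forall x, cylinder s x -> band b a (phi x) -> O (x, phi x)].
Proof.
move=> oO [[x t] [/(fenceP phi01) /andP[t0 tx] Ot]].
have [[A B] /= [Ax Bt] ABO] : nbhs (x, t) O by exact: open_nbhs_nbhs.
move: Ax; rewrite nbhsE => -[A' [oA' A'x] A'A].
have [s sx sA] := cylinder_basis oA' A'x.
have [e /= e0 eB] := Bt.
(* Bands contain only positive heights, so a point at height 0 is first replaced by a nearby one at
   positive height. *)
have [y [t' [sy /andP[t'0 t'y] /andP[et te]]]] : exists y (t' : R),
    [/\ cylinder s y, 0 < t' <= phi y & t - e < t' < t + e].
  have [tp|t_le0] := ltP 0 t; first by exists x, t; split=> //; lra.
  have [y sy y0] := phi_dense s; exists y, (Num.min (phi y) (e / 2)).
  have {t_le0}t0' : t = 0 by apply/le_anti; rewrite t0 t_le0.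
  by split=> //; case: (leP (phi y) (e / 2)) => *; lra.
(* The interval []l, u[] surrounds [t'] within distance [e] of [t]; the maximum with 0 keeps [l]
   positive, so that [ln l] inverts [expR]. *)
pose l := (Num.max 0 (t - e) + t') / 2; pose u := (t' + (t + e)) / 2.
have [l0 el lt'] : [/\ 0 < l, t - e < l & l < t'].
  by rewrite /l; case: (leP 0 (t - e)) => *; split; lra.
have [t'u ue] : t' < u /\ u < t + e by rewrite /u; split; lra.
have u0 : 0 < u by lra.
have [a] : exists q : rat, ratr q \in `]- ln u, - ln t'[.
  by apply: rat_in_itvoo; rewrite ltrN2 ltr_ln.
rewrite in_itv /= => /andP[ua a_t].
have [b] : exists q : rat, ratr q \in `]- ln t', - ln l[.
  by apply: rat_in_itvoo; rewrite ltrN2 ltr_ln.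
rewrite in_itv /= => /andP[t'b bl].
exists s, a, b; split.
- by rewrite -(ltr_rat R); lra.
- exists y => //; apply: lt_le_trans t'y.
  by rewrite -[ltRHS](lnK t'0) ltr_expR; lra.
- move=> z sz /andP[bz za]; apply: ABO; split=> /=; first exact/A'A/sA.
  apply: eB; rewrite /ball_ /=.
  have lb : l < expR (- ratr b) by rewrite -[ltLHS](lnK l0) ltr_expR; lra.
  have au : expR (- ratr a) < u by rewrite -[ltRHS](lnK u0) ltr_expR; lra.
  by rewrite ltr_norml; apply/andP; split; lra.
Qed.

Definition hits_bands := forall (s s' : seq bool) (a b c d : rat), a < b -> c < d ->
  (exists2 x, cylinder s x & expR (- ratr b) < phi x) ->
  (exists2 x, cylinder s' x & expR (- ratr d) < phi x) ->
  exists N, forall m, (N <= m)%N -> exists x,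
    [/\ cylinder s x, cylinder s' (iter m h x), band b a (phi x) &
        band d c (phi (iter m h x))].

Hypothesis phi_bands : hits_bands.

Lemma Lelek_fence_bands : Lelek_fence (fun=> 0) phi.
Proof.
split=> //.
  exists [set x | 0 < phi x] => // O [x Ox] oO.
  have [s sx sO] := cylinder_basis oO Ox; have [y sy y0] := phi_dense s.
  by exists y; split=> //; exact: sO.
move=> p fp B; rewrite nbhsE => -[W [oW Wp] WB].
have [|s [a [b [ab Ub sW]]]] := fence_localize oW; first by exists p.
(* With both targets equal, the starting point alone gives a graph point in [W]. *)
have [N /(_ N (leqnn N))[x [sx _ bx _]]] := phi_bands ab ab Ub Ub.
by exists (x, phi x); split; [exists x|exact/WB/sW].
Qed.

Lemma mixing_on_graph (hh : C * R -> C * R) :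
  (forall n x, iter n hh (x, phi x) = (iter n h x, phi (iter n h x))) ->
  mixing_on fen hh.
Proof.
move=> hhE U V oU oV fU fV.
have [s [a [b [ab Ub sU]]]] := fence_localize oU fU.
have [s' [c [d [cd Vd sV]]]] := fence_localize oV fV.
have [N HN] := phi_bands ab cd Ub Vd.
have graph x : fen (x, phi x).
  by apply/(fenceP phi01); rewrite lexx; have /andP[->] := phi01 x.
exists N => m /HN[x [sx sx' bx bx']].
exists (iter m h x, phi (iter m h x)); split.
  by exists (x, phi x); [split=> //; exact: sU|exact: hhE].
by split=> //; exact: sV.
Qed.

End LelekFence.

Theorem theorem7p5 (R : realType) (h : C -> C) :
  homeo_on [set: C] h ->
  mixing_on [set: C] h ->
  (forall U V : set C, open U -> open V -> U !=set0 -> V !=set0 ->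
     exists K : set C, exists m0 : nat,
       [/\ compact K, nowhere_dense K, h @` K = K &
           forall m, (m0 <= m)%N -> (iter m h @` (K `&` U)) `&` V !=set0]) ->
  exists phiL phiU : C -> R,
    [/\ admissible phiL phiU, Lelek_fence phiL phiU &
        exists hh : C * R -> C * R,
          [/\ lifting phiL phiU h hh,
              homeo_on (fence phiL phiU) hh &
              mixing_on (fence phiL phiU) hh]].
Proof.
move=> [hc' _ hinj _ [g gP gc']] _ recurrent_sets.
have hc : continuous h := iffRL (continuous_subspace_setT h) hc'.
have gc : continuous g := iffRL (continuous_subspace_setT g) gc'.
have gK : cancel g h by move=> x; have [] := gP x I.
have hK : cancel h g by move=> x; apply: hinj; rewrite ?inE// gK.
have [F [K [FK FS Kmeet Ftarget]]] :=
  @stage_sequence R h g hK gK hc gc recurrent_sets.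
pose phi := height F; pose w := drift h F.
have phi01 x : 0 <= phi x <= 1 by rewrite height_ge0 (height_le1 FK).
have phiM x : phi (h x) = phi x * expR (- w x) := height_drift FS x.
have wc : continuous w := continuous_drift FK FS hc.
have phi_dense s : exists2 x, cylinder s x & 0 < phi x.
  have [n [x [Kx sx]]] := Kmeet s; exists x => //.
  by rewrite /phi (height_stage FS Kx) expR_gt0.
have phi_bands : hits_bands h phi.
  move=> s s' a b c d ab cd [x sx bx] [y sy dy].
  have [n nP] := Ftarget s s' a b c d ab cd.
  (* Since [phi] is at most [expR (- F n)], a premise on the limit height yields the premise at the
     stage treating the request. *)
  have FltP z (q : rat) : expR (- ratr q) < phi z -> F n z < ratr q.
    by move=> /lt_le_trans/(_ (height_le F n z)); rewrite ltr_expR ltrN2.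
  have [||N HN] := nP; [by exists x; rewrite ?FltP|by exists y; rewrite ?FltP|].
  exists N => m /HN[z [Kz sz s'z abz cdz]]; exists z.
  (* By invariance the orbit of [z] stays in [K n.+1], so both heights are already final. *)
  have Kmz : K n.+1 (iter m h z).
    by have [_ _ /(thin_invariant_iter gK z m)[-> _]] := FK n.+1.
  split=> //; rewrite /band /phi /=;
    rewrite (height_stage FS Kz, height_stage FS Kmz) !ltr_expR !ltrN2.
    by rewrite andbC.
  by rewrite andbC.
exists (fun=> 0), phi; split.
- split=> // [x|x a a0||x]; first by rewrite lexx ler01.
  + by apply: filterS filterT => y _.
  + exact: (usc_height FK).
  + by have /andP[] := phi01 x.
- exact: (Lelek_fence_bands phi01 phi_dense phi_bands).
- exists (scale_fibers h w); split.
  + exact: (lifting_scale_fibers phi01 phiM).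
  + exact: (homeo_on_scale_fibers hK gK).
  + exact/(mixing_on_graph phi01 phi_dense phi_bands)/iter_scale_fibers_graph.
Qed.
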